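(* Let $G$ be a group generated by two $3$-Engel elements. Then $G$ has lower central series of length $\le 5$, i.e. $\gamma_5 G=\gamma_6 G=\gamma_7G=\dots$. In particular, this holds for $G=\mathcal G_1^+(L)$, where $L$ is any $2$-component link whose fundamental group $\pi(L)$ is generated by two meridians.
   Context: $[g,h]=g^{-1}h^{-1}gh$; $\gamma_1G=G$, $\gamma_{n+1}G=[\gamma_nG,G]$. An element $h$ of a group $G$ is a (left) $n$-Engel element if $[\dots[[g,h],h],\dots,h]=1$ ($n$ occurrences of $h$) for each $g\in G$. For a link $L$ in $S^3$, $\pi(L)=\pi_1(S^3\setminus L)$, and $\mathcal G^+_k(L)=\pi(L)/\delta_k$, where $\delta_k$ is the (normal) subgroup generated by all $[\dots[[g,m],m],\dots,m]$ ($k+2$ occurrences of $m$), with $m$ running over all meridians of $L$ and $g$ over $\pi(L)$. *)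

(* Defs.v *)
From HB Require Import structures.
From mathcomp Require Import all_boot all_order all_algebra.
From mathcomp Require Import all_classical all_reals all_analysis.
From mathcomp Require Import homotopy.
From mathcomp Require Import ring lra.
Set Implicit Arguments.
Unset Strict Implicit.
Unset Printing Implicit Defensive.
Import Order.TTheory GRing.Theory Num.Theory.
Import numFieldTopology.Exports numFieldNormedType.Exports.

Local Open Scope classical_set_scope.
Local Open Scope quotient_scope.

Section GroupNotions.
Local Open Scope group_scope.
Variable G : groupType.
Implicit Types (A B H : set G) (g h : G).

Definition generated A : set G :=
  smallest (fun H => group_closed (mem H)) A.

Definition commutator_subgroup A B : set G :=
  generated [set z | exists2 a, A a & exists2 b, B b & z = [~ a, b]].

(* Indexed from 1, as usual; the value at index 0 is a junk value. *)
Fixpoint lower_central (n : nat) : set G :=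
  if n is (m.+1 as p).+1 then commutator_subgroup (lower_central p) setT
  else setT.

Definition iter_commg n g h : G := iter n (fun z => [~ z, h]) g.

Definition left_engel n h : Prop := forall g, iter_commg n g h = 1.

End GroupNotions.

Arguments lower_central G n : clear implicits.

Record normal_subgroup (G : groupType) := NormalSubgroup {
  nsub_set :> set G;
  nsub_group : group_closed (mem nsub_set);
  nsub_conj : forall x g : G, nsub_set x -> nsub_set (x ^ g)%g }.

Section GeneratedTheory.
Local Open Scope group_scope.
Variable G : groupType.
Implicit Types (A : set G) (x y g : G).

Lemma generated_group A : group_closed (mem (generated A)).
Proof.
split=> [|x y]; first by rewrite inE => H [[]]; rewrite inE.
rewrite !inE => Ax Ay H HA; have [[_ Hd] _] := HA.
by have := Hd x y; rewrite !inE; apply; [exact: Ax | exact: Ay].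
Qed.

Lemma generated_conj A : (forall x g, A x -> A (x ^ g)) ->
  forall x g, generated A x -> generated A (x ^ g).
Proof.
move=> AJ x g Ax.
suff: generated A `<=` [set y | generated A (y ^ g)] by move=> /(_ x Ax).
apply: smallest_sub => [|y Ay]; last by apply: sub_gen_smallest; exact: AJ.
have [g1 gd] := generated_group A; split=> [|y z].
  by move: g1; rewrite !inE/= conj1g.
rewrite !inE/= => Ay Az; rewrite conjMg conjVg.
by have := gd (y ^ g) (z ^ g); rewrite !inE; apply.
Qed.

End GeneratedTheory.

Section QuotientGroup.
Local Open Scope group_scope.
Variables (G : groupType) (N : normal_subgroup G).
Implicit Types x y : G.

Let N1 : nsub_set N 1.
Proof. by have [] := nsub_group N; rewrite inE. Qed.

Let Nd x y : nsub_set N x -> nsub_set N y -> nsub_set N (x / y).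
Proof. by have [_ /(_ x y)] := nsub_group N; rewrite !inE. Qed.

Let NV x : nsub_set N x -> nsub_set N x^-1.
Proof. by rewrite -[x^-1]mul1g; exact: Nd. Qed.

Let NM x y : nsub_set N x -> nsub_set N y -> nsub_set N (x * y).
Proof. by move=> Nx Ny; rewrite -[y]invgK; exact/Nd/NV. Qed.

Definition coset_rel : rel G := fun x y => `[< nsub_set N (x^-1 * y) >].

Let coset_refl : reflexive coset_rel.
Proof. by move=> x; apply/asboolP; rewrite mulVg. Qed.

Let coset_sym : symmetric coset_rel.
Proof.
by move=> x y; apply/asboolP/asboolP => /NV; rewrite invgM invgK.
Qed.

Let coset_trans : transitive coset_rel.
Proof.
move=> y x z /asboolP xy /asboolP yz; apply/asboolP.
by have := NM xy yz; rewrite -mulgA mulVKg.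
Qed.

Definition coset_equiv := EquivRel coset_rel coset_refl coset_sym coset_trans.

Definition quotient_group : Type := {eq_quot coset_equiv}.

HB.instance Definition _ := Choice.on quotient_group.
HB.instance Definition _ := EqQuotient.on quotient_group.

Definition quot_proj : G -> quotient_group := \pi_quotient_group.

Lemma quot_projP x y : quot_proj x = quot_proj y <-> nsub_set N (x^-1 * y).
Proof.
by split=> [/eqquotP /asboolP//|xy]; apply/eqquotP/asboolP.
Qed.

Lemma quot_proj_surj (u : quotient_group) : exists x, u = quot_proj x.
Proof. by exists (repr u); rewrite /quot_proj reprK. Qed.

Definition quot_one : quotient_group := quot_proj 1.
Definition quot_inv (u : quotient_group) : quotient_group :=
  quot_proj (repr u)^-1.
Definition quot_mul (u v : quotient_group) : quotient_group :=
  quot_proj (repr u * repr v).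

Let repr_proj x : nsub_set N (x^-1 * repr (quot_proj x)).
Proof. by apply/quot_projP; rewrite /quot_proj reprK. Qed.

Let mulE x y : quot_mul (quot_proj x) (quot_proj y) = quot_proj (x * y).
Proof.
apply/esym/quot_projP; rewrite invgM.
set x' := repr _; set y' := repr _.
have -> : y^-1 * x^-1 * (x' * y') = (x^-1 * x') ^ y * (y^-1 * y').
  by rewrite conjgE !mulgA mulgK.
by apply: NM => //; apply: nsub_conj.
Qed.

Let invE x : quot_inv (quot_proj x) = quot_proj x^-1.
Proof.
apply/esym/quot_projP; set x' := repr _; rewrite invgK.
have -> : x * x'^-1 = ((x^-1 * x')^-1) ^ x^-1.
  by rewrite conjgE invgM !invgK !mulgA mulgK.
by apply/nsub_conj/NV.
Qed.

Let quot_mulA : associative quot_mul.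
Proof.
move=> u v w; have [x ->] := quot_proj_surj u; have [y ->] := quot_proj_surj v.
by have [z ->] := quot_proj_surj w; rewrite !mulE mulgA.
Qed.

Let quot_mul1g : left_id quot_one quot_mul.
Proof. by move=> u; have [x ->] := quot_proj_surj u; rewrite mulE mul1g. Qed.

Let quot_mulg1 : right_id quot_one quot_mul.
Proof. by move=> u; have [x ->] := quot_proj_surj u; rewrite mulE mulg1. Qed.

Let quot_mulVg : left_inverse quot_one quot_inv quot_mul.
Proof.
by move=> u; have [x ->] := quot_proj_surj u; rewrite invE mulE mulVg.
Qed.

Let quot_mulgV : right_inverse quot_one quot_inv quot_mul.
Proof.
by move=> u; have [x ->] := quot_proj_surj u; rewrite invE mulE mulgV.
Qed.

HB.instance Definition _ := isGroup.Build quotient_group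
  quot_mulA quot_mul1g quot_mulg1 quot_mulVg quot_mulgV.

Lemma quot_projM : {morph quot_proj : x y / x * y}.
Proof. by move=> x y; exact/esym/mulE. Qed.

Lemma quot_proj1 : quot_proj 1 = 1.
Proof. by []. Qed.

HB.instance Definition _ :=
  isUMagmaMorphism.Build G quotient_group quot_proj (quot_proj1, quot_projM).

End QuotientGroup.

Section UnitInterval.
Local Open Scope ring_scope.
Variable R : realType.

Definition unit_interval : Type := set_type (`[0, 1] : set R).

HB.instance Definition _ := Topological.on unit_interval.

Definition ui_val (t : unit_interval) : R := \val t.

Let clamp01 (t : R) : `[0, 1]%classic (Num.max 0 (Num.min 1 t)).
Proof. by rewrite /= in_itv/= le_max lexx/= ge_max ler01 ge_min lexx. Qed.

Definition clamp (t : R) : unit_interval := SigSub (mem_set (clamp01 t)).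

Lemma ui_val_ge0 t : 0 <= ui_val t.
Proof. by have := set_valP t; rewrite /= in_itv/= => /andP[]. Qed.

Lemma ui_val_le1 t : ui_val t <= 1.
Proof. by have := set_valP t; rewrite /= in_itv/= => /andP[]. Qed.

Lemma clampK t : ui_val (clamp t) = Num.max 0 (Num.min 1 t).
Proof. by []. Qed.

Lemma ui_valK t : clamp (ui_val t) = t.
Proof.
apply/val_inj; rewrite /= (min_idPr (ui_val_le1 t)).
exact: (max_idPr (ui_val_ge0 t)).
Qed.

Lemma ui_val_inj : injective ui_val.
Proof. by move=> s t /val_inj. Qed.

Lemma clamp_le0 t : t <= 0 -> clamp t = clamp 0.
Proof.
by move=> t0; apply/ui_val_inj; rewrite !clampK
  /Num.min /Num.max; do !case: ifP; lra.
Qed.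

Lemma clamp_ge1 t : 1 <= t -> clamp t = clamp 1.
Proof.
by move=> t0; apply/ui_val_inj; rewrite !clampK
  /Num.min /Num.max; do !case: ifP; lra.
Qed.

Let clamp0_neq1 : clamp 0 != clamp 1.
Proof.
apply/eqP => /(congr1 ui_val); rewrite !clampK /Num.min /Num.max.
by do !case: ifP; lra.
Qed.

HB.instance Definition _ :=
  isBiPointed.Build unit_interval clamp0_neq1.

Lemma ui_val_continuous : continuous ui_val.
Proof. exact: initial_continuous. Qed.

Lemma clamp_continuous : continuous clamp.
Proof.
apply: (@continuous_comp_initial _ _ _ (set_val : _ -> R)) => /= t.
apply: (@continuous_max R R (cst 0) (fun t => Num.min 1 t)).
  exact: cst_continuous.
apply: (@continuous_min R R (cst 1) id); first exact: cst_continuous.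
exact: cvg_id.
Qed.

Lemma clamp_comp_continuous (T X : topologicalType) (f : unit_interval -> X)
    (g : T -> R) : continuous f -> continuous g ->
  continuous (fun t => f (clamp (g t))).
Proof.
move=> cf cg t; apply: (@continuous_comp _ _ _ (clamp \o g) f); last exact: cf.
by apply: continuous_comp; [exact: cg | exact: clamp_continuous].
Qed.

End UnitInterval.

Section Paste.
Local Open Scope ring_scope.

Lemma fst_continuous (T U : topologicalType) : continuous (@fst T U).
Proof. by move=> u; exact: cvg_fst. Qed.

Lemma snd_continuous (T U : topologicalType) : continuous (@snd T U).
Proof. by move=> u; exact: cvg_snd. Qed.

Lemma pair_continuous (T U V : topologicalType) (f : T -> U) (g : T -> V) :
  continuous f -> continuous g -> continuous (fun t => (f t, g t)).
Proof. by move=> cf cg t; exact: cvg_pair (cf t) (cg t). Qed.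

Lemma comp_continuous (T U V : topologicalType) (g : U -> V) (f : T -> U) :
  continuous g -> continuous f -> continuous (fun t => g (f t)).
Proof. by move=> cg cf t; exact: continuous_comp (cf t) (cg _). Qed.

Lemma paste_continuous (R : realType) (T X : topologicalType) (a : T -> R)
    (c : R) (f g : T -> X) : continuous a -> continuous f -> continuous g ->
  (forall t, a t = c -> f t = g t) ->
  continuous (fun t => if a t <= c then f t else g t).
Proof.
move=> ca cf cg fg; pose h t := if a t <= c then f t else g t.
change (continuous h).
have cA : closed [set t | a t <= c].
  exact: (@closed_comp _ _ a [set x | x <= c]) (fun t _ => ca t) (@closed_le _ c).
have cB : closed [set t | c <= a t].
  exact: (@closed_comp _ _ a [set x | c <= x]) (fun t _ => ca t) (@closed_ge _ c).
apply/continuous_subspace_setT.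
have -> : [set: T] = [set t | a t <= c] `|` [set t | c <= a t].
  by apply/esym/seteqP; split=> // t _; case: (leP (a t) c) => [|/ltW]; [left|right].
apply: withinU_continuous => //.
- apply: (@subspace_eq_continuous _ _ _ (f : subspace _ -> X));
    last exact: continuous_subspaceT.
  by move=> t /set_mem/= atc; rewrite /from_subspace /h atc.
- apply: (@subspace_eq_continuous _ _ _ (g : subspace _ -> X));
    last exact: continuous_subspaceT.
  by move=> t /set_mem/= cat; rewrite /from_subspace /h; case: leP => // ac; apply/esym/fg/le_anti; rewrite ac.
Qed.

End Paste.

Section Homotopy.
Local Open Scope ring_scope.
Variables (R : realType) (X : topologicalType).
Local Notation I := (unit_interval R).

Definition homotopic (x y : X) (p q : {path I from x to y}) : Prop :=
  exists H : I * I -> X,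
    [/\ continuous H,
        (forall t, H (t, zero) = p t), (forall t, H (t, one) = q t),
        (forall s, H (zero, s) = x) & (forall s, H (one, s) = y)].

Section Operations.
Variables (x y z : X).

Definition rev_path_fun (p : {path I from x to y}) (t : I) : X :=
  p (clamp (1 - ui_val t)).

Definition cat_path_fun (p : {path I from x to y}) (q : {path I from y to z})
    (t : I) : X :=
  if ui_val t <= 2^-1 then p (clamp (2 * ui_val t))
  else q (clamp (2 * ui_val t - 1)).

Let uv0 : ui_val (zero : I) = 0.
Proof. by rewrite clampK min_r// max_r. Qed.

Let uv1 : ui_val (one : I) = 1.
Proof. by rewrite clampK min_r// max_r. Qed.

Let affine_continuous (a b : R) : continuous (fun t : I => a * ui_val t + b).
Proof.
move=> t; apply: (@continuous_comp _ _ _ (@ui_val R) (fun r => a * r + b)).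
  exact: ui_val_continuous.
apply: (@cvgD _ _ _ _ _ (fun r : R => a * r)); last exact: cvg_cst.
by apply: cvgM; [exact: cvg_cst | exact: cvg_id].
Qed.

Lemma rev_path_continuous p : continuous (rev_path_fun p).
Proof.
apply: clamp_comp_continuous; first exact: cts_fun.
have -> : (fun t : I => 1 - ui_val t) = fun t : I => -1 * ui_val t + 1.
  by apply/funext => t; ring.
exact: affine_continuous.
Qed.

Lemma rev_path0 p : rev_path_fun p zero = y.
Proof. by rewrite /rev_path_fun uv0 subr0 path_one. Qed.

Lemma rev_path1 p : rev_path_fun p one = x.
Proof. by rewrite /rev_path_fun uv1 subrr path_zero. Qed.

Definition rev_path p : {path I from y to x} :=
  mk_path (@rev_path_continuous p) (rev_path0 p) (rev_path1 p).

Lemma cat_path_continuous p q : continuous (cat_path_fun p q).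
Proof.
apply: paste_continuous; first exact: ui_val_continuous.
- apply: clamp_comp_continuous; first exact: cts_fun.
  have -> : (fun t : I => 2 * ui_val t) = fun t : I => 2 * ui_val t + 0.
    by apply/funext => t; rewrite addr0.
  exact: affine_continuous.
- apply: clamp_comp_continuous; [exact: cts_fun | exact: affine_continuous].
- move=> t ->; rewrite divff// subrr.
  by change (p one = q zero); rewrite path_one path_zero.
Qed.

Lemma cat_path0 p q : cat_path_fun p q zero = x.
Proof. by rewrite /cat_path_fun uv0 invr_ge0 ler0n mulr0 path_zero. Qed.

Lemma cat_path1 p q : cat_path_fun p q one = z.
Proof.
rewrite /cat_path_fun uv1 ifF; last by apply/negbTE; rewrite -ltNge; lra.
by rewrite (_ : 2 * 1 - 1 = 1 :> R) ?path_one//; lra.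
Qed.

Definition cat_path p q : {path I from x to z} :=
  mk_path (@cat_path_continuous p q) (cat_path0 p q) (cat_path1 p q).

End Operations.

Definition const_path (x : X) : {path I from x to x} := cst x.

Lemma ui_val0 : ui_val (zero : I) = 0.
Proof. by rewrite clampK min_r// max_r. Qed.

Lemma ui_val1 : ui_val (one : I) = 1.
Proof. by rewrite clampK min_r// max_r. Qed.

Let pair_comp (T : topologicalType) (H : I * I -> X) (f g : T -> I) :
  continuous H -> continuous f -> continuous g ->
  continuous (fun u => H (f u, g u)).
Proof.
by move=> cH cf cg; apply: (comp_continuous cH); exact: pair_continuous.
Qed.

Let square_continuous (g : R * R -> R) : continuous g ->
  continuous (fun u : I * I => g (ui_val u.1, ui_val u.2)).
Proof.
move=> cg; apply: (comp_continuous cg); apply: pair_continuous.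
- exact: (comp_continuous (@ui_val_continuous R) (@fst_continuous I I)).
- exact: (comp_continuous (@ui_val_continuous R) (@snd_continuous I I)).
Qed.

Let fst_affine (a b : R) :
  continuous (fun u : I * I => a * ui_val u.1 + b).
Proof.
apply: (@square_continuous (fun v => a * v.1 + b)) => u.
apply: (@cvgD _ _ _ _ _ (fun v : R * R => a * v.1)); last exact: cvg_cst.
by apply: cvgM; [exact: cvg_cst | exact: cvg_fst].
Qed.

Let snd_affine (a b : R) :
  continuous (fun u : I * I => a * ui_val u.2 + b).
Proof.
apply: (@square_continuous (fun v => a * v.2 + b)) => u.
apply: (@cvgD _ _ _ _ _ (fun v : R * R => a * v.2)); last exact: cvg_cst.
by apply: cvgM; [exact: cvg_cst | exact: cvg_snd].
Qed.

Let clamp_cont (T : topologicalType) (g : T -> R) :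
  continuous g -> continuous (fun t => clamp (g t) : I).
Proof. by move=> cg; apply: (@clamp_comp_continuous _ _ _ idfun) => // t; exact: cvg_id. Qed.

Let clamp_lo (t : R) : t <= 0 -> clamp t = zero.
Proof. exact: clamp_le0. Qed.

Let clamp_hi (t : R) : 1 <= t -> clamp t = one.
Proof. exact: clamp_ge1. Qed.

Lemma homotopic_reparam (x y : X) (p q : {path I from x to y})
    (P : R -> X) (phi psi : R -> R) :
  continuous P -> continuous phi -> continuous psi ->
  phi 0 = psi 0 -> phi 1 = psi 1 ->
  (forall t, p t = P (phi (ui_val t))) ->
  (forall t, q t = P (psi (ui_val t))) -> homotopic p q.
Proof.
move=> cP cphi cpsi e0 e1 pE qE.
pose g (v : R * R) := (1 - v.2) * phi v.1 + v.2 * psi v.1.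
have cg : continuous g.
  move=> v; apply: (@cvgD _ _ _ _ _ (fun v : R * R => (1 - v.2) * phi v.1)).
    apply: (@cvgM _ _ _ _ (fun v : R * R => 1 - v.2)).
      by apply: cvgB; [exact: cvg_cst | exact: cvg_snd].
    exact: (comp_continuous cphi (@fst_continuous R R)).
  apply: (@cvgM _ _ _ _ (fun v : R * R => v.2)); first exact: cvg_snd.
  exact: (comp_continuous cpsi (@fst_continuous R R)).
exists (fun u => P (g (ui_val u.1, ui_val u.2))); split.
- by apply: (comp_continuous cP); exact: square_continuous.
- by move=> t; rewrite /g/= ui_val0 pE; congr P; ring.
- by move=> t; rewrite /g/= ui_val1 qE; congr P; ring.
- move=> s; rewrite /g/= ui_val0 -e0 -[RHS](path_zero (s := p)) pE ui_val0.
  by congr P; ring.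
- move=> s; rewrite /g/= ui_val1 -e1 -[RHS](path_one (s := p)) pE ui_val1.
  by congr P; ring.
Qed.

Lemma homotopic_refl (x y : X) (p : {path I from x to y}) : homotopic p p.
Proof.
exists (fun u => p u.1); split => //; last 2 first.
- by move=> s; rewrite path_zero.
- by move=> s; rewrite path_one.
exact: (comp_continuous (@cts_fun _ _ p) (@fst_continuous I I)).
Qed.

Lemma homotopic_sym (x y : X) (p q : {path I from x to y}) :
  homotopic p q -> homotopic q p.
Proof.
case=> H [cH H0 H1 Hx Hy].
exists (fun u => H (u.1, clamp (-1 * ui_val u.2 + 1))); split => //=.
- apply: pair_comp cH _ _; first exact: fst_continuous.
  exact/clamp_cont/snd_affine.
- by move=> t; rewrite ui_val0 clamp_hi//; lra.
- by move=> t; rewrite ui_val1 clamp_lo//; lra.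
Qed.

Lemma homotopic_trans (x y : X) (q p r : {path I from x to y}) :
  homotopic p q -> homotopic q r -> homotopic p r.
Proof.
case=> H [cH H0 H1 Hx Hy] [K [cK K0 K1 Kx Ky]].
exists (fun u => if ui_val u.2 <= 2^-1 then H (u.1, clamp (2 * ui_val u.2 + 0))
                 else K (u.1, clamp (2 * ui_val u.2 + -1))); split => /=.
- apply: (@paste_continuous R _ _ (fun u : I * I => ui_val u.2)).
  + have -> : (fun u : I * I => ui_val u.2) = fun u : I * I => 1 * ui_val u.2 + 0.
      by apply/funext => u; ring.
    exact: snd_affine.
  + apply: pair_comp cH _ _; first exact: fst_continuous.
  exact/clamp_cont/snd_affine.
  + apply: pair_comp cK _ _; first exact: fst_continuous.
  exact/clamp_cont/snd_affine.
  + move=> u ->; rewrite clamp_hi; last lra.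
    by rewrite clamp_lo ?H1 ?K0//; lra.
- by move=> t; rewrite ui_val0 ifT ?clamp_lo//; lra.
- by move=> t; rewrite ui_val1 ifF ?clamp_hi//; lra.
- by move=> s; case: ifP.
- by move=> s; case: ifP.
Qed.

Lemma homotopic_cat (x y z : X) (p p' : {path I from x to y})
    (q q' : {path I from y to z}) :
  homotopic p p' -> homotopic q q' ->
  homotopic (cat_path p q) (cat_path p' q').
Proof.
case=> H [cH H0 H1 Hx Hy] [K [cK K0 K1 Kx Ky]].
exists (fun u => if ui_val u.1 <= 2^-1 then H (clamp (2 * ui_val u.1 + 0), u.2)
                 else K (clamp (2 * ui_val u.1 + -1), u.2)); split => /=.
- apply: (@paste_continuous R _ _ (fun u : I * I => ui_val u.1)).
  + have -> : (fun u : I * I => ui_val u.1) = fun u : I * I => 1 * ui_val u.1 + 0.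
      by apply/funext => u; ring.
    exact: fst_affine.
  + apply: pair_comp cH _ _; last exact: snd_continuous.
  exact/clamp_cont/fst_affine.
  + apply: pair_comp cK _ _; last exact: snd_continuous.
  exact/clamp_cont/fst_affine.
  + move=> u ->; rewrite clamp_hi; last lra.
    by rewrite clamp_lo ?Hy ?Kx//; lra.
- by move=> t; rewrite H0 K0 addr0.
- by move=> t; rewrite H1 K1 addr0.
- by move=> s; rewrite ui_val0 ifT ?clamp_lo//; lra.
- by move=> s; rewrite ui_val1 ifF ?clamp_hi//; lra.
Qed.

Lemma homotopic_rev (x y : X) (p p' : {path I from x to y}) :
  homotopic p p' -> homotopic (rev_path p) (rev_path p').
Proof.
case=> H [cH H0 H1 Hx Hy].
exists (fun u => H (clamp (-1 * ui_val u.1 + 1), u.2)); split => //=.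
- apply: pair_comp cH _ _; last exact: snd_continuous.
  exact/clamp_cont/fst_affine.
- by move=> t; rewrite H0; congr (p (clamp _)); ring.
- by move=> t; rewrite H1; congr (p' (clamp _)); ring.
- by move=> t; rewrite ui_val0 clamp_hi//; lra.
- by move=> t; rewrite ui_val1 clamp_lo//; lra.
Qed.

Lemma rev_pathK (x y : X) (p : {path I from x to y}) :
  rev_path (rev_path p) = p.
Proof.
apply/path_eqP => t; rewrite /= /mk_path/= /rev_path_fun/= /mk_path /rev_path_fun.
have t0 := ui_val_ge0 t; have t1 := ui_val_le1 t.
rewrite -[in RHS](ui_valK t); congr (p (clamp _)); rewrite clampK.
by rewrite min_r ?max_r//; lra.
Qed.

Lemma rev_cat_path (x y z : X) (p : {path I from x to y})
    (q : {path I from y to z}) :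
  rev_path (cat_path p q) = cat_path (rev_path q) (rev_path p).
Proof.
apply/path_eqP => t.
rewrite /= /mk_path/= /rev_path_fun/cat_path_fun/= /mk_path /rev_path_fun /cat_path_fun.
have t0 := ui_val_ge0 t; have t1 := ui_val_le1 t.
rewrite !clampK.
rewrite (min_r (x := 1) (y := 1 - ui_val t)); last lra.
rewrite (max_r (x := 0) (y := 1 - ui_val t)); last lra.
case: leP => h1; case: leP => h2; last by exfalso; lra.
- have -> : ui_val t = 2^-1 by lra.
  rewrite clamp_hi ?path_one; last lra.
  rewrite (min_r (x := 1)) ?(max_r (x := 0)); [|lra..].
  by rewrite clamp_lo ?path_zero//; lra.
- congr (p (clamp _)); rewrite min_r ?max_r; lra.
- congr (q (clamp _)); rewrite min_r ?max_r; lra.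
Qed.

Let ext_continuous (x y : X) (p : {path I from x to y}) :
  continuous (fun t : R => p (clamp t)).
Proof.
by apply: clamp_comp_continuous => [|t]; [exact: cts_fun | exact: cvg_id].
Qed.

Let id_continuous : continuous (fun t : R => t).
Proof. by move=> t; exact: cvg_id. Qed.

Let line_continuous (a b : R) : continuous (fun t : R => a * t + b).
Proof.
move=> t; apply: (@cvgD _ _ _ _ _ (fun r : R => a * r)); last exact: cvg_cst.
by apply: cvgM; [exact: cvg_cst | exact: cvg_id].
Qed.

Let min_cont (f g : R -> R) : continuous f -> continuous g ->
  continuous (fun t => Num.min (f t) (g t)).
Proof.
by move=> cf cg t; apply: (@continuous_min R R f g t); [exact: cf | exact: cg].
Qed.

Let max_cont (f g : R -> R) : continuous f -> continuous g ->
  continuous (fun t => Num.max (f t) (g t)).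
Proof.
by move=> cf cg t; apply: (@continuous_max R R f g t); [exact: cf | exact: cg].
Qed.

Lemma cat_const_path (x y : X) (p : {path I from x to y}) :
  homotopic (cat_path (const_path x) p) p.
Proof.
apply: (@homotopic_reparam _ _ _ _ (fun t => p (clamp t))
  (fun t => Num.max (0 * t + 0) (2 * t + -1)) id).
- exact: ext_continuous.
- by apply: max_cont; exact: line_continuous.
- exact: id_continuous.
- by rewrite /Num.max; case: ifP; lra.
- by rewrite /Num.max; case: ifP; lra.
- move=> t; rewrite /= /mk_path /cat_path_fun mul0r addr0.
  case: leP => h; last by rewrite max_r//; lra.
  by rewrite max_l; [exact/esym/(path_zero (s := p)) | lra].
- by move=> t; rewrite ui_valK.
Qed.

Lemma cat_path_const (x y : X) (p : {path I from x to y}) :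
  homotopic (cat_path p (const_path y)) p.
Proof.
apply: (@homotopic_reparam _ _ _ _ (fun t => p (clamp t))
  (fun t => Num.min (0 * t + 1) (2 * t + 0)) id).
- exact: ext_continuous.
- by apply: min_cont; exact: line_continuous.
- exact: id_continuous.
- by rewrite /Num.min; case: ifP; lra.
- by rewrite /Num.min; case: ifP; lra.
- move=> t; rewrite /= /mk_path /cat_path_fun mul0r add0r addr0.
  case: leP => h; first by rewrite min_r//; lra.
  by rewrite min_l; [exact/esym/(path_one (s := p)) | lra].
- by move=> t; rewrite ui_valK.
Qed.

Lemma cat_path_rev (x y : X) (p : {path I from x to y}) :
  homotopic (cat_path p (rev_path p)) (const_path x).
Proof.
apply: (@homotopic_reparam _ _ _ _ (fun t => p (clamp t))
  (fun t => Num.min (2 * t + 0) (-2 * t + 2)) (fun t => 0 * t + 0)).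
- exact: ext_continuous.
- by apply: min_cont; exact: line_continuous.
- exact: line_continuous.
- by rewrite /Num.min; case: ifP; lra.
- by rewrite /Num.min; case: ifP; lra.
- move=> t; rewrite /= /mk_path /cat_path_fun /= /mk_path /rev_path_fun addr0.
  have t0 := ui_val_ge0 t; have t1 := ui_val_le1 t.
  case: leP => h; first by rewrite min_l//; lra.
  rewrite clampK (min_r (x := 1)) ?max_r; [|lra..].
  by rewrite min_r; [congr (p (clamp _)); ring | lra].
- by move=> t; rewrite clamp_lo ?path_zero//; lra.
Qed.

Lemma cat_pathA (x y z w : X) (p : {path I from x to y})
    (q : {path I from y to z}) (r : {path I from z to w}) :
  homotopic (cat_path (cat_path p q) r) (cat_path p (cat_path q r)).
Proof.
apply: (@homotopic_reparam _ _ _ _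
  (fun t => cat_path p (cat_path q r) (clamp t))
  (fun t => Num.min (2 * t + 0) (Num.min (1 * t + 4^-1) (2^-1 * t + 2^-1))) id).
- exact: ext_continuous.
- by do 2?apply: min_cont; exact: line_continuous.
- exact: id_continuous.
- by rewrite /Num.min; do !case: ifP; lra.
- by rewrite /Num.min; do !case: ifP; lra.
- move=> t; have t0 := ui_val_ge0 t; have t1 := ui_val_le1 t.
  rewrite /= /mk_path /cat_path_fun /= /mk_path /cat_path_fun.
  set v := ui_val t in t0 t1 *; rewrite !clampK.
  case: (leP v 2^-1) => h1.
    rewrite (min_r (x := 1) (y := 2 * v)); last lra.
    rewrite (max_r (x := 0) (y := 2 * v)); last lra.
    case: (leP (2 * v) 2^-1) => h2.
      rewrite (min_l (x := 2 * v + 0)); last by rewrite le_min; lra.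
      rewrite (min_r (x := 1) (y := 2 * v + 0)) ?(max_r (x := 0) (y := 2 * v + 0)); [|lra..].
      rewrite ifT; last lra.
      by congr (p (clamp _)); lra.
    rewrite (min_l (x := 1 * v + 4^-1)); last lra.
    rewrite (min_r (x := 2 * v + 0)); last lra.
    rewrite (min_r (x := 1) (y := 1 * v + 4^-1)); last lra.
    rewrite (max_r (x := 0) (y := 1 * v + 4^-1)); last lra.
    rewrite ifF; last lra.
    rewrite (min_r (x := 1)) ?max_r; [|lra..].
    by rewrite ifT; [congr (q (clamp _)); lra | lra].
  rewrite (min_r (x := 1 * v + 4^-1)); last lra.
  rewrite (min_r (x := 2 * v + 0)); last lra.
  rewrite (min_r (x := 1) (y := 2^-1 * v + 2^-1)); last lra.
  rewrite (max_r (x := 0) (y := 2^-1 * v + 2^-1)); last lra.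
  rewrite ifF; last lra.
  rewrite (min_r (x := 1)) ?max_r; [|lra..].
  by rewrite ifF; [congr (r (clamp _)); lra | lra].
- by move=> t; rewrite ui_valK.
Qed.

End Homotopy.

Section FundamentalGroup.
Variables (R : realType) (X : topologicalType) (x0 : X).
Local Notation I := (unit_interval R).
Local Notation loop := {path I from x0 to x0}.

Definition loop_rel : rel loop := fun p q => `[< homotopic p q >].

Let loop_refl : reflexive loop_rel.
Proof. by move=> p; apply/asboolP/homotopic_refl. Qed.

Let loop_sym : symmetric loop_rel.
Proof. by move=> p q; apply/asboolP/asboolP; exact: homotopic_sym. Qed.

Let loop_trans : transitive loop_rel.
Proof.
move=> q p r /asboolP pq /asboolP qr; apply/asboolP.
exact: homotopic_trans pq qr.
Qed.

Definition loop_equiv := EquivRel loop_rel loop_refl loop_sym loop_trans.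

Definition pi1 : Type := {eq_quot loop_equiv}.

HB.instance Definition _ := Choice.on pi1.
HB.instance Definition _ := EqQuotient.on pi1.

Definition loop_class : loop -> pi1 := \pi_pi1.

Lemma loop_classP p q : loop_class p = loop_class q <-> homotopic p q.
Proof. by split=> [/eqquotP /asboolP//|pq]; apply/eqquotP/asboolP. Qed.

Lemma loop_class_surj (g : pi1) : exists p, g = loop_class p.
Proof. by exists (repr g); rewrite /loop_class reprK. Qed.

Definition pi1_one : pi1 := loop_class (const_path R x0).
Definition pi1_inv (g : pi1) : pi1 := loop_class (rev_path (repr g)).
Definition pi1_mul (g h : pi1) : pi1 := loop_class (cat_path (repr g) (repr h)).

Let repr_class p : homotopic (repr (loop_class p)) p.
Proof. by apply/loop_classP; rewrite /loop_class reprK. Qed.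

Let mulE p q :
  pi1_mul (loop_class p) (loop_class q) = loop_class (cat_path p q).
Proof. exact/loop_classP/homotopic_cat. Qed.

Let invE p : pi1_inv (loop_class p) = loop_class (rev_path p).
Proof. exact/loop_classP/homotopic_rev. Qed.

Let pi1_mulA : associative pi1_mul.
Proof.
move=> g h k; have [p ->] := loop_class_surj g; have [q ->] := loop_class_surj h.
have [r ->] := loop_class_surj k; rewrite !mulE.
exact/loop_classP/homotopic_sym/cat_pathA.
Qed.

Let pi1_mul1g : left_id pi1_one pi1_mul.
Proof.
move=> g; have [p ->] := loop_class_surj g; rewrite mulE.
exact/loop_classP/cat_const_path.
Qed.

Let pi1_mulg1 : right_id pi1_one pi1_mul.
Proof.
move=> g; have [p ->] := loop_class_surj g; rewrite mulE.
exact/loop_classP/cat_path_const.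
Qed.

Let pi1_mulgV : right_inverse pi1_one pi1_inv pi1_mul.
Proof.
move=> g; have [p ->] := loop_class_surj g; rewrite invE mulE.
exact/loop_classP/cat_path_rev.
Qed.

Let pi1_mulVg : left_inverse pi1_one pi1_inv pi1_mul.
Proof.
move=> g; have [p ->] := loop_class_surj g; rewrite invE mulE.
by rewrite -[in X in cat_path _ X](rev_pathK p); exact/loop_classP/cat_path_rev.
Qed.

HB.instance Definition _ := isGroup.Build pi1
  pi1_mulA pi1_mul1g pi1_mulg1 pi1_mulVg pi1_mulgV.

Lemma loop_classM p q :
  loop_class (cat_path p q) = (loop_class p * loop_class q)%g.
Proof. exact/esym/mulE. Qed.

Lemma loop_classV p : loop_class (rev_path p) = ((loop_class p)^-1)%g.
Proof. exact/esym/invE. Qed.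

Lemma loop_class_conj (y : X) (p : {path I from x0 to y})
    (c : {path I from y to y}) (q : loop) :
  (loop_class (cat_path p (cat_path c (rev_path p))) ^ loop_class q)%g =
  let p' := cat_path (rev_path q) p in
  loop_class (cat_path p' (cat_path c (rev_path p'))).
Proof.
rewrite conjgE -loop_classV -(loop_classM _ q) -loop_classM.
rewrite /= rev_cat_path rev_pathK.
apply/loop_classP.
apply: (@homotopic_trans _ _ _ _
  (cat_path (rev_path q) (cat_path p (cat_path c (cat_path (rev_path p) q))))).
  apply: homotopic_cat; first exact: homotopic_refl.
  apply: homotopic_trans (cat_pathA _ _ _) _.
  apply: homotopic_cat; first exact: homotopic_refl.
  exact: cat_pathA.
exact/homotopic_sym/cat_pathA.
Qed.

End FundamentalGroup.

Section Links.
Local Open Scope ring_scope.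
Variable R : realType.
Local Notation I := (unit_interval R).

Definition unit_sphere (n : nat) : set 'rV[R]_n.+1 :=
  [set v | \sum_i v 0 i ^+ 2 = 1].

Local Notation S1 := (set_type (@unit_sphere 1%N)).
Local Notation S3 := (set_type (@unit_sphere 3%N)).

Definition z_axis : set 'rV[R]_3 := [set v | v 0 0 = 0 /\ v 0 1 = 0].

(* An open embedding of R^3 in S^3 carrying the pair (R^3, z-axis) onto
   (U, U `&` K), where U is its range. *)
Definition flat_chart (K : set (S3)) (f : 'rV[R]_3 -> S3) : Prop :=
  [/\ continuous f, injective f, forall U, open U -> open (f @` U)
    & f @^-1` K = z_axis].

(* Tame links: piecewise linear and smooth links are locally flat, and in
   dimension 3 every locally flat link is ambient homeomorphic to a piecewise
   linear one.  The components are numbered and parametrized. *)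
Record link (n : nat) := Link {
  link_component : 'I_n -> S1 -> S3;
  link_continuous : forall i, continuous (link_component i);
  link_injective : forall i j s t,
    link_component i s = link_component j t -> i = j /\ s = t;
  link_locally_flat : forall i s,
    exists2 f, flat_chart (\bigcup_j range (link_component j)) f &
               f 0 = link_component i s }.

Section LinkGroup.
Variables (n : nat) (L : link n).

Definition link_image : set (S3) := \bigcup_j range (link_component L j).

Definition link_complement : Type := set_type (~` link_image).

HB.instance Definition _ := Topological.on link_complement.

Variable x0 : link_complement.

Definition link_group : Type := pi1 R x0.

HB.instance Definition _ := Group.on link_group.

Definition unit_circle (t : R) : 'rV[R]_3 :=
  \row_j [:: cos (2 * pi * t); sin (2 * pi * t); 0]`_j.

(* Loops that follow a path, turn once around the link along the unit circle
   of a flat chart, and come back.  Since charts may reverse the orientation,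
   the inverse of a meridian is a meridian. *)
Definition meridian : set link_group :=
  [set m | exists (f : 'rV[R]_3 -> S3) (y : link_complement)
      (p : {path I from x0 to y}) (c : {path I from y to y}),
    [/\ flat_chart link_image f,
        forall t, \val (c t) = f (unit_circle (ui_val t))
      & m = loop_class (cat_path p (cat_path c (rev_path p)))]].

Lemma meridian_conj m g : meridian m -> meridian (m ^ g)%g.
Proof.
move=> [f [y [p [c [fK cE ->]]]]]; have [q ->] := loop_class_surj g.
exists f, y, (cat_path (rev_path q) p), c; split=> //.
exact: loop_class_conj.
Qed.

Definition delta (k : nat) : set link_group :=
  generated [set z | exists2 m, meridian m & exists g, z = iter_commg k.+2 g m].

Lemma delta_conj k x g : delta k x -> delta k (x ^ g)%g.
Proof.
apply: generated_conj => {x g} _ g [m mL [h ->]].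
exists (m ^ g)%g; first exact: meridian_conj.
exists (h ^ g)%g; elim: k.+2 => [//|j IHj].
by rewrite /iter_commg /= conjRg; congr ([~ _, _])%g.
Qed.

Definition delta_normal (k : nat) : normal_subgroup link_group :=
  NormalSubgroup (generated_group _) (@delta_conj k).

Definition G_plus (k : nat) : Type := quotient_group (delta_normal k).

HB.instance Definition _ k := Group.on (G_plus k).

End LinkGroup.
End Links.

(* Main.v *)
Require Import Defs.
From mathcomp Require Import all_boot all_order all_algebra.
From mathcomp Require Import all_classical all_reals all_analysis.

Set Implicit Arguments.
Unset Strict Implicit.

Local Open Scope classical_set_scope.

(** Let [c] be the commutator of the generators [a] and [b].  It is enough to
show that the fifth term of the lower central series equals the sixth, and
passing to the quotient by the sixth we may assume that this one is trivial;
then the fifth term has to vanish, i.e. both generators have to centralize the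
fourth term.

As [a] and [b] generate the group, the fourth term is spanned, modulo the fifth
(which is central), by the commutators [c, x, y] with [x] and [y] in {a, b}
([lower_central_span]).  By the symmetry between [a] and [b] it is enough that
[a] commutes with these four elements.  The Engel identity gives [c, b, b] = 1,
since [c, b, b] = [a, b, b, b].  It also gives [c, a, a] = 1: a left 3-Engel
element generates with each of its conjugates a group of class at most two
([left_3engel_commg_conj]), and [a ^ g = a * [~ a, g]].

The associated graded Lie ring alone does not give the two mixed commutators:
the relations [b, a, a, a] = 0 = [a, b, b, b] define, over the rationals, an
infinite-dimensional algebra, the positive part of the affine Lie algebra of
type A_1^(1).  The missing relation comes from comparing [a ^ b] with
[a ^ (b * b)].  Since [a, b * b] = c * c * [c, b], the relation
[a, b * b, a, a] = 1 expands, after [c, a, a] = 1 is used, into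
[c, b, a, a] = 1 ([commute_abba]).  Finally [c, a, b] and [c, b, a] agree
modulo the fifth term, because [c] commutes with itself ([commute_abab]).

For a link group, the quotient by the subgroup that kills the iterated
commutators with meridians turns the two generating meridians into left 3-Engel
generators. *)

Section GroupTheory.
Local Open Scope group_scope.
Implicit Type G : groupType.

(** * Commutator identities *)

Lemma commMg_conj G (x y z : G) : [~ x * y, z] = [~ x, z] ^ y * [~ y, z].
Proof. by rewrite !commgEl conjMg invgM -!mulgA !conjgE ?gnorm. Qed.

Lemma commgM_conj G (x y z : G) : [~ x, y * z] = [~ x, z] * [~ x, y] ^ z.
Proof. by rewrite !commgEl !conjgE ?gnorm. Qed.

Lemma commVg_conj G (x y : G) : [~ x^-1, y] = [~ x, y]^-1 ^ x^-1.
Proof. by rewrite !commgEl !conjgE ?gnorm. Qed.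

Lemma commgV_conj G (x y : G) : [~ x, y^-1] = [~ x, y]^-1 ^ y^-1.
Proof. by rewrite !commgEl !conjgE ?gnorm. Qed.

Lemma conjg_commg G (x y : G) : x ^ y = x * [~ x, y].
Proof. by rewrite commgEl mulVKg. Qed.

Lemma hall_witt G (x y z : G) :
  [~ x, y^-1, z] ^ y * [~ y, z^-1, x] ^ z * [~ z, x^-1, y] ^ x = 1.
Proof. by rewrite !commgEl !conjgE ?gnorm. Qed.

Lemma commute_commg1 G (x y : G) : commute x y <-> [~ x, y] = 1.
Proof. by split=> [/commgP/eqP|/eqP/commgP]. Qed.

(** * Generated subgroups and the lower central series *)

Lemma group_closedP G (H : set G) : H 1 ->
  (forall x y, H x -> H y -> H (x * y)) -> (forall x, H x -> H x^-1) ->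
  group_closed (mem H).
Proof.
by move=> H1 HM HV; split=> [|x y]; rewrite !inE // => Hx Hy; apply/HM/HV.
Qed.

Lemma group1_mem G (H : set G) : group_closed (mem H) -> H 1.
Proof. by case=> + _; rewrite inE. Qed.

Lemma groupM_mem G (H : set G) : group_closed (mem H) ->
  forall x y, H x -> H y -> H (x * y).
Proof. by move=> /group_closedM HM x y; have := HM x y; rewrite !inE. Qed.

Lemma groupV_mem G (H : set G) : group_closed (mem H) ->
  forall x, H x -> H x^-1.
Proof. by move=> /group_closedV HV x; have := HV x; rewrite !inE. Qed.

Lemma generated_subset G (A H : set G) : group_closed (mem H) ->
  A `<=` H -> generated A `<=` H.
Proof. exact: smallest_sub. Qed.

Lemma subset_generated G (A : set G) : A `<=` generated A.
Proof. exact: sub_gen_smallest. Qed.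

Lemma generatedS G (A B : set G) : A `<=` B -> generated A `<=` generated B.
Proof.
move=> AB; apply: generated_subset (generated_group B) _.
exact: subset_trans AB (@subset_generated G B).
Qed.

Lemma centralizer_group G (a : G) : group_closed (mem [set x | commute a x]).
Proof.
apply: group_closedP => [|x y|x]; first exact: commute1.
- exact: commuteM.
- exact: commuteV.
Qed.

Lemma lower_central_group G n : group_closed (mem (lower_central G n)).
Proof.
by case: n => [|[|n]]; [apply: group_closedP..|exact: generated_group].
Qed.

Lemma lower_central_commg G n (x g : G) :
  lower_central G n.+1 x -> lower_central G n.+2 [~ x, g].
Proof. by move=> xn; apply: subset_generated; exists x => //; exists g. Qed.

Lemma lower_central_conj G n (x g : G) :
  lower_central G n x -> lower_central G n (x ^ g).
Proof.
elim: n x g => [|[|n] IHn] // x g.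
apply: generated_conj => {g}_ g [y yn [k _ ->]].
by exists (y ^ g); [exact: IHn | exists (k ^ g) => //; rewrite conjRg].
Qed.

Lemma lower_central_decr G n : lower_central G n.+1 `<=` lower_central G n.
Proof.
elim: n => [|[|n] IHn] //; apply: generatedS => _ [x xn [g _ ->]].
by exists x; [exact: IHn | exists g].
Qed.

(** The three subgroups lemma, by induction on [j]: the Hall-Witt identity
rewrites a commutator with [~ u, g] into two commutators in which [u], of weight
one less, occurs alone. *)
Lemma lower_central_commg_add G i j (x y : G) :
  lower_central G i.+1 x -> lower_central G j.+1 y ->
  lower_central G (i + j).+2 [~ x, y].
Proof.
elim: j i x y => [|j IHj] i x y xi yj.
  by rewrite addn0; exact: lower_central_commg.
move: y yj i x xi.
have gG k := lower_central_group G k.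
suff: lower_central G j.+2 `<=`
    [set y | forall i x, lower_central G i.+1 x ->
             lower_central G (i + j.+1).+2 [~ x, y]] by [].
apply: generated_subset => [|_ [u uj [g _ ->]] i x xi].
  apply: group_closedP => [i x _|y z yP zP i x xi|y yP i x xi].
  - by rewrite commg1; exact: group1_mem.
  - rewrite commgM_conj; apply: (groupM_mem (gG _)); first exact: zP.
    by apply: lower_central_conj; exact: yP.
  - by rewrite commgV_conj; apply: lower_central_conj; apply: (groupV_mem (gG _)); exact: yP.
rewrite -invgR; apply: (groupV_mem (gG _)).
have /(canRL (mulgK _)) /(canRL (mulKg _)) := hall_witt x u g^-1.
rewrite invgK mul1g => /(canRL (conjgK _)) ->.
apply: lower_central_conj; apply: (groupM_mem (gG _)); apply: (groupV_mem (gG _)).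
- rewrite addnS; apply: lower_central_conj; apply: lower_central_commg.
  by apply: IHj => //; exact: (groupV_mem (gG _)).
- apply: lower_central_conj; rewrite -addSnnS; apply: IHj => //.
  rewrite -invgR; apply: (groupV_mem (gG _)); apply: lower_central_commg.
  exact: (groupV_mem (gG _)).
Qed.

(** Modulo [lower_central G n.+3] the commutator map from
[lower_central G n.+1] times [G] is bilinear, because conjugation acts trivially
on [lower_central G n.+2]; so generators suffice in both arguments. *)
Lemma lower_central_span G n (A S : set G) :
  generated A = [set: G] -> S `<=` lower_central G n.+1 ->
  lower_central G n.+1 `<=` generated (S `|` lower_central G n.+2) ->
  lower_central G n.+2 `<=`
    generated ([set [~ s, a] | s in S & a in A] `|` lower_central G n.+3).
Proof.
move=> genA Sn spanS; set N := generated _.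
have gG k := lower_central_group G k.
have gN : group_closed (mem N) by exact: generated_group.
have NJ u g : lower_central G n.+2 u -> N u -> N (u ^ g).
  move=> un Nu; rewrite conjg_commg; apply: (groupM_mem gN) => //.
  by apply: subset_generated; right; exact: lower_central_commg.
have NS s : S s -> forall g, N [~ s, g].
  move=> Ss; have sn g : lower_central G n.+2 [~ s, g].
    by apply: lower_central_commg; exact: Sn.
  suff: generated A `<=` [set g | N [~ s, g]].
    by rewrite genA => sN g; exact: sN.
  (* linearity in the second argument, for a generator on the left *)
  apply: generated_subset => [|a Aa].
    apply: group_closedP => [|g h Ng Nh|g Ng] /=.
    - by rewrite commg1; exact: (group1_mem gN).
    - by rewrite commgM_conj; apply: (groupM_mem gN) => //; exact: NJ.
    - rewrite commgV_conj; apply: NJ; [exact: (groupV_mem (gG _)) | exact: (groupV_mem gN)].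
  by apply: subset_generated; left; exists s => //; exists a.
apply: generated_subset => // _ [x xn [g _ ->]]; move: x xn g.
suff: lower_central G n.+1 `<=`
    [set x | lower_central G n.+1 x /\ forall g, N [~ x, g]].
  by move=> sub x xn g; have [_] := sub x xn.
(* Linearity in the first argument.  Membership in the term of the series has to
be carried along, since conjugation is harmless only for such elements. *)
apply: subset_trans spanS _; apply: generated_subset => [|x].
  apply: group_closedP => [|x y [xn Nx] [yn Ny]|x [xn Nx]].
  - split=> [|g]; first exact: (group1_mem (gG _)).
    by rewrite comm1g; exact: (group1_mem gN).
  - split=> [|g]; first exact: (groupM_mem (gG _)).
    rewrite commMg_conj; apply: (groupM_mem gN) => //.
    by apply: NJ => //; exact: lower_central_commg.
  - split=> [|g]; first exact: (groupV_mem (gG _)).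
    rewrite commVg_conj; apply: NJ; last exact: (groupV_mem gN).
    by apply: (groupV_mem (gG _)); exact: lower_central_commg.
case=> [Sx|xn]; first by split; [exact: Sn | exact: NS].
split=> [|g]; first exact: lower_central_decr.
by apply: subset_generated; right; exact: lower_central_commg.
Qed.

(** * Homomorphic images *)

Lemma generated_image (G Q : groupType) (f : UMagmaMorphism.type G Q)
    (A : set G) : generated (f @` A) = f @` generated A.
Proof.
have gA := generated_group A; have gfA := generated_group (f @` A).
apply/seteqP; split.
  apply: generated_subset.
    apply: group_closedP => [|_ _ [x Ax <-] [y Ay <-]|_ [x Ax <-]].
    - by exists 1; [exact: (group1_mem gA) | exact: gmulf1].
    - by exists (x * y); [exact: (groupM_mem gA) | exact: gmulfM].
    - by exists x^-1; [exact: (groupV_mem gA) | exact: gmulfV].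
  by move=> _ [x Ax <-]; exists x => //; exact: subset_generated.
suff: generated A `<=` [set x | generated (f @` A) (f x)].
  by move=> sub _ [x Ax <-]; exact: sub.
apply: generated_subset => [|x Ax].
  apply: group_closedP => [|x y|x] /=.
  - by rewrite gmulf1; exact: (group1_mem gfA).
  - by rewrite gmulfM; exact: (groupM_mem gfA).
  - by rewrite gmulfV; exact: (groupV_mem gfA).
by apply: subset_generated; exists x.
Qed.

Lemma lower_central_image (G Q : groupType) (f : UMagmaMorphism.type G Q) n :
  (forall u, exists x, u = f x) ->
  lower_central Q n = f @` lower_central G n.
Proof.
move=> fsurj; have imT : [set: Q] = f @` [set: G].
  by apply/seteqP; split=> // u _; have [x ->] := fsurj u; exists x.
elim: n => [|[|n] IHn] //.
rewrite /= /commutator_subgroup -generated_image; congr generated.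
apply/seteqP; split=> [_ [u + [v _ ->]]|_ [_ [x xn [g _ ->]] <-]].
  rewrite -/(lower_central Q n.+1) IHn => -[x xn <-]; have [g ->] := fsurj v.
  by exists [~ x, g]; [exists x => //; exists g | exact: gmulfR].
exists (f x); first by rewrite -/(lower_central Q n.+1) IHn; exists x.
by exists (f g) => //; exact: gmulfR.
Qed.

(** Only the images of the iterated commutators matter, so that the lemma
applies to quotients in which an element becomes an Engel element. *)
Lemma left_engel_image (G Q : groupType) (f : UMagmaMorphism.type G Q) n h :
  (forall u, exists x, u = f x) -> (forall g, f (iter_commg n g h) = 1) ->
  left_engel n (f h).
Proof.
move=> fsurj fE u; have [g ->] := fsurj u; rewrite -(fE g).
by elim: n {fE} => //= n IHn; rewrite -/(iter_commg _ _ _) IHn gmulfR.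
Qed.

Definition lower_central_normal G n : normal_subgroup G :=
  NormalSubgroup (lower_central_group G n) (@lower_central_conj G n).

(** * Left 3-Engel elements *)

(** With [y := a ^ g], the Engel identity at [g] says that [a] commutes with
[q := [~ a^-1, y^-1]], and the identity at [g^-1], conjugated by [g], says the
same of [y].  Hence [q] is central in the group generated by [a] and [y], and it
is conjugate there to [~ a, y]. *)
Lemma left_3engel_commg_conj G (a g : G) :
  left_engel 3 a -> commute a [~ a, a ^ g].
Proof.
move=> engel_a.
have a_comm h : commute a [~ a^-1, (a ^ h)^-1].
  apply/esym/commute_commg1/(conjg_inj (a * a)); rewrite conj1g -(engel_a h).
  by rewrite /iter_commg /= !commgEl !conjgE !gnorm.
set y := a ^ g; set q := [~ a^-1, y^-1].
have y_comm : commute y q.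
  have /commute_commg1 := a_comm g^-1.
  move=> /(congr1 (fun x => x ^ g)); rewrite conj1g !conjRg !conjVg conjgKV -/y.
  by move=> y_comm; rewrite /q -invgR; apply/commuteV/commute_commg1.
have -> : [~ a, y] = q ^ (y * a) by rewrite !commgEl !conjgE !gnorm.
have /commute_commg1/eqP/conjg_fixP -> : commute q (y * a).
  by apply: commuteM; apply: commute_sym => //; exact: a_comm.
exact: a_comm.
Qed.

(** The form with [~ a, g] on the inside, where the Engel identity itself would
have [~ g, a]. *)
Lemma left_3engel_conj_commg G (a g : G) :
  left_engel 3 a -> commute a [~ [~ a, g], a].
Proof.
move=> /(left_3engel_commg_conj g) aC.
have -> : [~ [~ a, g], a] = [~ a, a ^ g]^-1.
  by rewrite invgR !commgEl !conjgE !gnorm.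
exact: commuteV.
Qed.

Section ClassFive.
Variables (G : groupType) (a b : G).
Hypotheses (engel_a : left_engel 3 a) (engel_b : left_engel 3 b).
Hypothesis class5 : lower_central G 6 `<=` [set 1].

Let c := [~ a, b].

Let lower_central_commute i j x y : 6 <= (i + j).+2 ->
  lower_central G i.+1 x -> lower_central G j.+1 y -> commute x y.
Proof.
move=> ij xi yj; apply/commute_commg1/class5.
have := lower_central_commg_add xi yj.
have [n ->] : exists n, (i + j).+2 = n + 6.
  by exists ((i + j).+2 - 6); rewrite subnK.
elim: n => [//|n IHn] /lower_central_decr; exact: IHn.
Qed.

Let c_in : lower_central G 2 c.
Proof. exact: lower_central_commg. Qed.

(** With [x := [~ c, a]] and [f := [~ c, b]], [a] commutes with
[~ a, b * b, a] = [~ c * (c * f), a], which is a product of two factors [x], of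
[~ f, a] and of a central element; and [a] commutes with [x]. *)
Lemma commute_abba : commute a [~ [~ c, b], a].
Proof.
set x := [~ c, a]; set f := [~ c, b].
have x_in : lower_central G 3 x by exact: lower_central_commg.
have f_in : lower_central G 3 f by exact: lower_central_commg.
have ax : commute a x by exact: left_3engel_conj_commg.
have := left_3engel_conj_commg (b * b) engel_a.
have -> : [~ a, b * b] = c * (c * f) by rewrite commgM_conj conjg_commg.
rewrite commMg_conj -/x conjg_commg [[~ c * f, a]]commMg_conj -/x.
have /commute_commg1 : commute x f by exact: (@lower_central_commute 2 2).
rewrite (conjg_commg x f) => ->; rewrite mulg1.
set t := [~ x, c * f]; set u := [~ f, a] => a_prod.
(* weight 3 + 2: [t] lies in the fifth term, which is central *)
have at_ : commute a t.
  apply/esym/(@lower_central_commute 4 0) => //.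
  apply: (@lower_central_commg_add G 2 1) => //.
  apply: (groupM_mem (lower_central_group G 2)) => //.
  exact: lower_central_decr.
have -> : u = x^-1 * (t^-1 * (x^-1 * (x * t * (x * u)))).
  by clearbody x t u; rewrite !mulgA !gnorm.
by do 3?[apply: commuteM; first exact: commuteV].
Qed.

(** [a * b = b * a * c], so [~ c, a * b] and [~ c, b * a] differ by
[~ [~ c, b * a], c], which has weight 5.  Expanding both, [~ c, a, b] and
[~ c, b, a] differ by a central element. *)
Lemma commute_abab : commute a [~ [~ c, a], b].
Proof.
have ac := commute_abba; move: ac.
set x := [~ c, a]; set f := [~ c, b] => afa.
have x_in : lower_central G 3 x by exact: lower_central_commg.
have f_in : lower_central G 3 f by exact: lower_central_commg.
have xf : x * f = f * x by exact: (@lower_central_commute 2 2).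
have ab_eq : [~ c, a * b] = f * x * [~ x, b].
  by rewrite commgM_conj conjg_commg mulgA.
have ba_eq : [~ c, b * a] = x * f * [~ f, a].
  by rewrite commgM_conj conjg_commg mulgA.
set z := [~ [~ c, b * a], c].
have az : commute a z.
  apply/esym/(@lower_central_commute 4 0) => //.
  by apply: (@lower_central_commg_add G 2 1) => //; exact: lower_central_commg.
have : [~ c, a * b] = [~ c, b * a] * z.
  by rewrite commgC commgM_conj commgg mul1g conjg_commg.
rewrite ab_eq ba_eq xf -[RHS]mulgA => /mulgI ->; exact: commuteM.
Qed.

Lemma commute_lower_central4 (genG : generated [set a; b] = [set: G]) y :
  lower_central G 4 y -> commute a y.
Proof.
have span2 : lower_central G 2 `<=` generated ([set c] `|` lower_central G 3).
  have := @lower_central_span G 0 _ [set a; b] genG.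
  move=> /(_ (fun _ _ => I)) span.
  apply: subset_trans (span _) _.
    by apply: subset_trans (generatedS (@subsetUl _ _ _)); rewrite genG.
  have gN := generated_group ([set c] `|` lower_central G 3).
  have Nc : generated ([set c] `|` lower_central G 3) c.
    by apply: subset_generated; left.
  apply: generated_subset => // z [[x xab [h hab <-]]|z3]; last first.
    by apply: subset_generated; right.
  case: xab => ->; case: hab => ->; rewrite ?commgg //; try exact: (group1_mem gN).
  by rewrite -invgR; exact: (groupV_mem gN).
have c2 : [set c] `<=` lower_central G 2 by move=> _ ->.
have span3 := lower_central_span genG c2 span2.
have span4 := lower_central_span genG _ span3.
move: y; apply: subset_trans (span4 _) _.
  by move=> _ [_ -> [g _ <-]]; exact: lower_central_commg.
apply: generated_subset; first exact: centralizer_group.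
move=> y [[_ [_ -> [g gab <-]] [h hab <-]]|y5]; last first.
  exact/esym/(@lower_central_commute 4 0).
case: gab => ->; case: hab => ->.
- have /commute_sym/commute_commg1 -> := left_3engel_conj_commg b engel_a.
  exact: commute1.
- exact: commute_abab.
- exact: commute_abba.
- have -> : [~ [~ c, b], b] = 1 by exact: (engel_b a).
  exact: commute1.
Qed.

End ClassFive.

Lemma lower_central5_class5 G (a b : G) :
  left_engel 3 a -> left_engel 3 b -> generated [set a; b] = [set: G] ->
  lower_central G 6 `<=` [set 1] -> lower_central G 5 `<=` [set 1].
Proof.
move=> ea eb genG class5.
apply: generated_subset.
  by apply: group_closedP => [//|x y -> ->|x ->]; rewrite ?mulg1 ?invg1.
move=> _ [x x4 [g _ ->]]; apply/commute_commg1.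
suff : generated [set a; b] `<=` [set h | commute x h] by rewrite genG; exact.
apply: generated_subset; first exact: centralizer_group.
move=> _ [] ->; apply/esym.
  exact: (commute_lower_central4 ea eb).
by apply: (commute_lower_central4 eb ea) => //; rewrite setUC.
Qed.

(** Passage to the quotient by the sixth term, where the class is at most
five. *)
Lemma lower_central_stable G (a b : G) :
  left_engel 3 a -> left_engel 3 b -> generated [set a; b] = [set: G] ->
  forall n, 5 <= n -> lower_central G n = lower_central G 5.
Proof.
move=> ea eb genG.
suff step : lower_central G 6 = lower_central G 5.
  move=> n /subnK <-; elim: (n - 5) => [//|k IHk]; rewrite addSn -[RHS]step.
  by rewrite addnS /= -/(lower_central G (k + 4).+1) -addnS IHk.
apply/seteqP; split; first exact: lower_central_decr.
pose N := lower_central_normal G 6; pose p : G -> quotient_group N := quot_proj N.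
have psurj : forall u, exists x, u = p x by exact: quot_proj_surj.
have pK x : p x = 1 -> lower_central G 6 x.
  move=> /esym/(quot_projP N).
  by rewrite invg1 mul1g.
have engel_p x : left_engel 3 x -> left_engel 3 (p x).
  move=> ex; apply: left_engel_image => // g; rewrite ex; exact: gmulf1.
have genp : generated [set p a; p b] = [set: quotient_group N].
  have <- : p @` [set a; b] = [set p a; p b] by rewrite image_setU !image_set1.
  rewrite generated_image genG; apply/seteqP; split=> // u _.
  by have [x ->] := psurj u; exists x.
have class5 : lower_central (quotient_group N) 6 `<=` [set 1].
  rewrite (@lower_central_image _ _ p) // => _ [x x6 <-].
  by apply/esym/(quot_projP N); rewrite invg1 mul1g.
move=> x x5; apply: pK.
apply: (lower_central5_class5 (engel_p a ea) (engel_p b eb)) => //.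
by rewrite (@lower_central_image _ _ p) //; exists x.
Qed.

End GroupTheory.

Theorem theorem3p9 :
  (forall (G : groupType) (a b : G),
     left_engel 3 a -> left_engel 3 b -> generated [set a; b] = [set: G] ->
     forall n, 5 <= n -> lower_central G n = lower_central G 5) /\
  (forall (R : realType) (L : link R 2) (x0 : link_complement L),
     (exists m1 m2 : link_group x0,
        [/\ meridian m1, meridian m2
          & generated [set m1; m2] = [set: link_group x0]]) ->
     forall n, 5 <= n ->
       lower_central (G_plus x0 1) n = lower_central (G_plus x0 1) 5).
Proof.
split=> [G a b|R L x0 [m1 [m2 [mer1 mer2 gen12]]]].
  exact: lower_central_stable.
pose N := delta_normal x0 1; pose p : link_group x0 -> G_plus x0 1 := quot_proj N.
have psurj : forall u, exists x, u = p x by exact: quot_proj_surj.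
have engel_p m : meridian m -> left_engel 3 (p m).
  move=> mer; apply: left_engel_image => // g.
  apply/esym/(quot_projP N); rewrite invg1 mul1g.
  by apply: subset_generated; exists m => //; exists g.
apply: (@lower_central_stable _ (p m1) (p m2)); try exact: engel_p.
have <- : p @` [set m1; m2] = [set p m1; p m2] by rewrite image_setU !image_set1.
rewrite generated_image gen12; apply/seteqP; split=> // u _.
by have [x ->] := psurj u; exists x.
Qed.
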